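(* For none of the $32$ orientation words $(\operatorname{sgn}D(0,1,2),\operatorname{sgn}D(0,2,3),\operatorname{sgn}D(0,3,4),\operatorname{sgn}D(0,4,5),\operatorname{sgn}D(0,5,1))\in\{+,-\}^5$, where $D(i,j,k)=\det(p_j-p_i,p_k-p_i)$, does there exist a configuration $P$ of $n$ labelled points in $[0,1]^2$ ($n\ge7$, labels including $0,1,\dots,5$ and one further label $e$) with $\Delta=\delta(P)>0$ and $\mathcal K(P)\neq\emptyset$ satisfying all of the following (indices $1,\dots,5$ read cyclically): (C0) $\dim H_0=2$, $\dim W=1$; label $0$ is the unique stress-silent vertex; and there are a basis $(f_1,f_2)$ of $\mathbb R^2$ and a velocity $v$ representing a generator of $W$ with $v_0=f_2$ and $v_i=\xi_if_1$, $1\le i\le5$ (that is, in the coordinates given by $(f_1,f_2)$ the shadow points are $Q_0=(0,1)$, $Q_i=(\xi_i,0)$); (C1) the five rows $(0,1,2),(0,2,3),(0,3,4),(0,4,5),(0,5,1)$ are tight but unsupported; (C2) every other triangle on the labels $0,\dots,5$ is strict, i.e. has area $>\Delta$; (C3) $\xi_{i+1}-\xi_i\ne0$ for every $i\in\{1,\dots,5\}$ (cyclically); (C4) each of the labels $1,\dots,5$ is not stress-silent; (C5) the first-order trace equations hold on every tight row ($DA_t(P)[v]=0$ for every tight triangle $t$), and the shadow coordinates of $v$ lie in the kernel of every stress $B(q)$, $q\in\mathcal K(P)$; (C6) for a multiplier in the relative interior of $\mathcal K(P)$ (hence positive on the maximal support), there is a positive component whose vertex set consists of the five labels $1,\dots,5$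 and exactly the one further label $e$, and in the same normalization $v_e=\xi_ef_1$, i.e. $Q_e=(\xi_e,0)$; (C7) the full KKT equilibrium ($Bz=2\mathrm i b$ for actual multipliers), the partial moment identities, the square boundary conditions and the inactive inequalities (all triangle areas $\ge\Delta$, all points in $[0,1]^2$) hold.
   Context: Let $P=(p_i)$ be a configuration of $n$ labelled points $p_i=(x_i,y_i)\in[0,1]^2$. For a triple $t=(i,j,k)$ (in a fixed order of labels) put $D_t(P)=\det(p_j-p_i,p_k-p_i)$, $A_t(P)=\tfrac12|D_t(P)|$, $\delta(P)=\min_tA_t(P)=:\Delta>0$. Triangle $t$ is tight if $A_t(P)=\Delta$. Put $s_t=\operatorname{sgn}D_t(P)$; near $P$, $A_t=\tfrac12s_tD_t$, which is used for derivatives. A normalized KKT multiplier at $P$ is a tuple $q=(\lambda,\ell,r,d,u)$ of nonnegative reals $\lambda_t$ (all triples $t$), $\ell_i,r_i,d_i,u_i$ (all labels $i$) with: $\lambda_t=0$ unless $t$ is tight; $\ell_i=0$ unless $x_i=0$, $r_i=0$ unless $x_i=1$, $d_i=0$ unless $y_i=0$, $u_i=0$ unless $y_i=1$; $\sum_t\lambda_t=1$; and $\sum_t\lambda_t\nabla_{p_i}A_t(P)+(\ell_i-r_i,d_i-u_i)=0$ for all $i$. Their set is the polytope $\mathcal K(P)$; the outward reaction is $b_i=(r_i-\ell_i)+\mathrm i(u_i-d_i)$. For $t=(i,j,k)$ let $B_t=s_t(a_tc_t^T-c_ta_t^T)$, $a_t=e_j-e_i$, $c_t=e_k-e_i$,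 and $B=B(q)=\sum_t\lambda_tB_t$; with $z_i=x_i+\mathrm i y_i$ the equilibrium is $Bz=2\mathrm i b$. The partial moment identities say: for any family $\mathcal H$ of tight triangles with weights from one multiplier, defining $b^{\mathcal H}$ by $(\sum_{t\in\mathcal H}\lambda_tB_t)z=2\mathrm i b^{\mathcal H}$, one has $\sum_ib_i^{\mathcal H}=0$ and $\sum_ip_i(b_i^{\mathcal H})^T=(\sum_{t\in\mathcal H}\lambda_t)\Delta I_2$. The maximal positive support is the set of tight constraints with positive multiplier for some $q\in\mathcal K(P)$; a relative-interior point of $\mathcal K(P)$ is positive exactly on it. A tight triangle is unsupported if $\lambda_t=0$ for all $q\in\mathcal K(P)$. A label is stress-silent if it belongs to no triangle in the maximal positive support. A positive component is the vertex set of a connected component, containing at least one hyperedge, of the hypergraph whose hyperedges are the triangles with positive multiplier (relative-interior multiplier). The shared kernel is $K_{\mathrm{sh}}=\bigcap_{q\in\mathcal K(P)}\ker B(q)$, which contains the all-ones vector $\mathbf 1$; $H_0=K_{\mathrm{sh}}/\langle\mathbf 1\rangle$. Velocities are $v=(\xi,\eta)\in\mathbb R^n\oplus\mathbb R^n$, $v_i=(\xi_i,\eta_i)\in\mathbb R^2$. $J^{\mathrm{tr}}_{\mathrm{tight}}$ is the linear map with rows: $v\mapsto DA_t(P)[v]$ for all tight $t$; differences of first coordinates of $v_i,v_j$ for all $i,j$ with $x_i,x_j\in\{0,1\}$; differences of second coordinates of $v_i,v_j$ for all $i,j$ with $y_i,y_j\in\{0,1\}$. With $T_{\mathrm{tr}}=\operatorname{span}\{(\mathbf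 1,0),(0,\mathbf 1)\}$, $W=\big((K_{\mathrm{sh}}\oplus K_{\mathrm{sh}})\cap\ker J^{\mathrm{tr}}_{\mathrm{tight}}\big)/T_{\mathrm{tr}}$. *)

(* Defs.v *)
From HB Require Import structures.
From mathcomp Require Import all_boot all_order all_algebra.
From mathcomp Require Import all_classical all_reals all_analysis.
From mathcomp Require Import complex.

Set Implicit Arguments.
Unset Strict Implicit.
Unset Printing Implicit Defensive.

Import Order.TTheory GRing.Theory Num.Theory.
Import numFieldNormedType.Exports.

Local Open Scope classical_set_scope.
Local Open Scope ring_scope.
Local Open Scope complex_scope.

(* Row i of a configuration P is the point p_i = (x_i, y_i); row i of a
   velocity v (same type) is v_i, and its two columns are xi and eta. *)
Notation config R n := 'M[R]_(n, 2).

Notation xcoord := (0 : 'I_2).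
Notation ycoord := (1 : 'I_2).

Section Triples.
Variable n : nat.

(* A triangle is a triple of labels listed in increasing order. *)
Definition triple :=
  {t : 'I_n * 'I_n * 'I_n | (t.1.1 < t.1.2)%N && (t.1.2 < t.2)%N}.

Definition tri1 (t : triple) : 'I_n := (val t).1.1.
Definition tri2 (t : triple) : 'I_n := (val t).1.2.
Definition tri3 (t : triple) : 'I_n := (val t).2.
Definition verts (t : triple) : {set 'I_n} := [set tri1 t; tri2 t; tri3 t]%SET.

(* Index set of the multipliers (lambda, l, r, d, u): Tri t carries lambda_t,
   and Left i, Right i, Down i, Up i carry l_i, r_i, d_i, u_i, for the walls
   x = 0, x = 1, y = 0, y = 1. *)
Inductive constr :=
  Tri of triple | Left of 'I_n | Right of 'I_n | Down of 'I_n | Up of 'I_n.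

End Triples.

Section Configurations.
Variables (R : realType) (n : nat).
Implicit Types (P v : config R n) (t : triple n) (q : constr n -> R).

Definition D3 P (i j k : 'I_n) : R :=
  \det (col_mx (row j P - row i P) (row k P - row i P) : 'M[R]_2).

Definition Dt t P : R := D3 P (tri1 t) (tri2 t) (tri3 t).

Definition area t P : R := 2^-1 * `|Dt t P|.

(* The infimum ranges over finitely many areas, hence is their minimum as soon
   as there is at least one triangle. *)
Definition mindelta P : R := inf [set area t P | t in [set: triple n]].

Definition tight P t : Prop := area t P = mindelta P.

Definition in_square P : Prop := forall i c, 0 <= P i c <= 1.

Definition DA t P v : R := 'D_v (area t) P.

Definition grad_area t P (i : 'I_n) (c : 'I_2) : R := DA t P (delta_mx i c).

Definition wall_complementarity P q : Prop := forall i : 'I_n,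
  [/\ P i xcoord <> 0 -> q (Left i) = 0, P i xcoord <> 1 -> q (Right i) = 0,
      P i ycoord <> 0 -> q (Down i) = 0 & P i ycoord <> 1 -> q (Up i) = 0].

(* Normalized KKT multipliers at P, i.e. the polytope K(P). *)
Definition KKT P : set (constr n -> R) := [set q |
  [/\ (forall c, 0 <= q c),
      (forall t, ~ tight P t -> q (Tri t) = 0),
      wall_complementarity P q,
      \sum_t q (Tri t) = 1 &
      forall i : 'I_n,
        \sum_t q (Tri t) * grad_area t P i xcoord
          + (q (Left i) - q (Right i)) = 0 /\
        \sum_t q (Tri t) * grad_area t P i ycoord
          + (q (Down i) - q (Up i)) = 0]].

(* Affine hull and relative interior (interior relative to the affine hull,
   for the sup norm) of a set of multipliers. *)
Definition affine_hull (K : set (constr n -> R)) : set (constr n -> R) :=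
  [set q | exists (m : nat) (w : 'I_m -> R) (k : 'I_m -> constr n -> R),
    [/\ forall j, K (k j), \sum_j w j = 1 &
        forall c, q c = \sum_j w j * k j c]].

Definition relint (K : set (constr n -> R)) : set (constr n -> R) :=
  [set q | K q /\ exists2 eps : R, 0 < eps &
    forall q', affine_hull K q' -> (forall c, `|q' c - q c| < eps) -> K q'].

Definition Bt P t : 'M[R]_n :=
  let a : 'cV[R]_n := delta_mx (tri2 t) 0 - delta_mx (tri1 t) 0 in
  let c : 'cV[R]_n := delta_mx (tri3 t) 0 - delta_mx (tri1 t) 0 in
  Num.sg (Dt t P) *: (a *m c^T - c *m a^T).

Definition partial_stress P q (H : {set triple n}) : 'M[R]_n :=
  \sum_(t in H) q (Tri t) *: Bt P t.

Definition stress P q : 'M[R]_n := \sum_t q (Tri t) *: Bt P t.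

Definition zvec P : 'cV[R[i]]_n := \col_i (P i xcoord +i* P i ycoord).

Definition reaction q : 'cV[R[i]]_n :=
  \col_i ((q (Right i) - q (Left i)) +i* (q (Up i) - q (Down i))).

Definition equilibrium P q : Prop :=
  map_mx (real_complex R) (stress P q) *m zvec P = (2 * 'i) *: reaction q.

Definition vec_of_complex (b : R[i]) : 'rV[R]_2 :=
  row_mx (complex.Re b)%:M (complex.Im b)%:M.

Definition partial_moments P q : Prop :=
  forall (H : {set triple n}) (b : 'cV[R[i]]_n),
    (forall t, t \in H -> tight P t) ->
    map_mx (real_complex R) (partial_stress P q H) *m zvec P = (2 * 'i) *: b ->
    \sum_i b i 0 = 0 /\
    \sum_i (row i P)^T *m vec_of_complex (b i 0)
      = ((\sum_(t in H) q (Tri t)) * mindelta P)%:M.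

Definition supported P t : Prop := exists2 q, KKT P q & 0 < q (Tri t).

Definition unsupported P t : Prop := forall q, KKT P q -> q (Tri t) = 0.

Definition stress_silent P (i : 'I_n) : Prop :=
  forall t, tight P t -> supported P t -> i \notin verts t.

Definition hadj q : rel 'I_n :=
  [rel i j | [exists t, [&& 0 < q (Tri t), i \in verts t & j \in verts t]]].

Definition positive_component q (S : {set 'I_n}) : Prop :=
  (exists i, S = [set j | connect (hadj q) i j]%SET) /\
  (exists t, 0 < q (Tri t) /\ verts t \subset S).

Definition Ksh P : set 'cV[R]_n :=
  [set x | forall q, KKT P q -> stress P q *m x = 0].

Definition ker_Jtr P : set (config R n) := [set v |
  [/\ forall t, tight P t -> DA t P v = 0,
      forall i j, (P i xcoord = 0 \/ P i xcoord = 1) ->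
        (P j xcoord = 0 \/ P j xcoord = 1) -> v i xcoord - v j xcoord = 0 &
      forall i j, (P i ycoord = 0 \/ P i ycoord = 1) ->
        (P j ycoord = 0 \/ P j ycoord = 1) -> v i ycoord - v j ycoord = 0]].

Definition ones : 'cV[R]_n := const_mx 1.

Definition Ttr : {vspace config R n} :=
  <<[:: row_mx ones (0 : 'cV[R]_n) : config R n;
        row_mx (0 : 'cV[R]_n) ones : config R n]>>%VS.

(* The numerator of W = Wnum / Ttr. *)
Definition Wnum P : set (config R n) :=
  [set v | Ksh P (col xcoord v) /\ Ksh P (col ycoord v)] `&` ker_Jtr P.

End Configurations.

Section Quotients.
Variables (R : realType) (V : vectType R).

(* U / T has dimension d, for T a subspace of the subspace U: the classes of
   some w_1, ..., w_d in U form a basis of U / T. *)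
Definition quotient_dim (U : set V) (T : {vspace V}) (d : nat) : Prop :=
  exists w : 'I_d -> V,
    [/\ forall i, U (w i),
        (forall c : 'I_d -> R, \sum_i c i *: w i \in T -> forall i, c i = 0) &
        (forall u, U u -> exists c : 'I_d -> R, u - \sum_i c i *: w i \in T)].

(* The class of v generates the line U / T. *)
Definition represents_generator (U : set V) (T : {vspace V}) (v : V) : Prop :=
  U v /\ forall u, U u -> exists c : R, u - c *: v \in T.

End Quotients.

Section Labels.
Variables (n : nat) (hn : (7 <= n)%N).

(* The labels 0, ..., 5; rim k is the label k + 1 for k = 0, ..., 4, and
   rim (ordS k) is its cyclic successor among 1, ..., 5. *)
Definition core (k : 'I_6) : 'I_n := widen_ord (ltnW hn) k.
Definition hub : 'I_n := core ord0.
Definition rim (k : 'I_5) : 'I_n := core (lift ord0 k).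
Definition core_labels : {set 'I_n} := [set core k | k : 'I_6]%SET.
Definition rim_labels : {set 'I_n} := [set rim k | k : 'I_5]%SET.

Definition wheel_row (k : 'I_5) : {set 'I_n} :=
  [set hub; rim k; rim (ordS k)]%SET.

End Labels.

(* Main.v *)
Require Import Defs.
From HB Require Import structures.
From mathcomp Require Import all_boot all_order all_algebra.
From mathcomp Require Import all_classical all_reals all_analysis.
From mathcomp Require Import complex.
From mathcomp Require Import lra ring.

(* Let M be the restriction to the rim 1, ..., 5 of the stress B of a relative
   interior multiplier.  By (C2) every positive triangle meeting the rim is
   {e, i, j}, so, in coordinates centred at e, M is antisymmetric, M_ij has the
   sign of det(p_i, p_j), M xi = 0, and (trace equations) M_ij <> 0 forces
   xi_i b_j = xi_j b_i, where b_i = det(f1, p_i).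
   On N = {i | xi_i <> 0} these relations give sum_(j in N) M_ij b_j = 0.
   Pairing with the f1-components of the p_i yields
   sum_(i, j in N) |M_ij det(p_i, p_j)| = 0, so N carries no edge.  Every i in N
   then has a neighbour z with xi_z = b_z = 0; such a z is unique because e and
   all such points are collinear.  By (C3) at most two xi_i vanish, and the
   graph of M is the star with centre z and the four other rim labels as leaves.
   In equilibrium the reaction at each leaf is nonzero and normal to z - e.  If
   z - e is oblique, the leaves sit at two opposite corners of the square, which
   is impossible.  If it is, say, horizontal, two leaves lie on each of the
   walls y = 0 and y = 1, e and z are midpoints of the other two walls, hence
   Delta = 1/4, and the strict inequalities (C2) cannot all hold. *)

Set Implicit Arguments.
Unset Strict Implicit.
Unset Printing Implicit Defensive.

Import Order.TTheory GRing.Theory Num.Theory.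
Import numFieldNormedType.Exports.

Local Open Scope classical_set_scope.
Local Open Scope ring_scope.

(** The 5-cycle has independence number two. With (C3) this will bound by two the number of rim
    labels whose shadow coordinate equals that of [e]. *)
Lemma ordS5_three (i j k : 'I_5) : i != j -> i != k -> j != k ->
  exists a b : 'I_5, [/\ a \in [:: i; j; k], b \in [:: i; j; k] & b = ordS a].
Proof.
move=> ij ik jk.
have : [exists a : 'I_5, (a \in [:: i; j; k]) && (ordS a \in [:: i; j; k])].
  apply: contraT => /existsPn H.
  move: (H i) (H j) (H k) ij ik jk; rewrite !inE -!val_eqE /= {H}.
  case: i => [[|[|[|[|[|i]]]]] hi] //; case: j => [[|[|[|[|[|j]]]]] hj] //=;
  by case: k => [[|[|[|[|[|k]]]]] hk].
by case/existsP=> a /andP[ha hb]; exists a, (ordS a).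
Qed.

(** * Shape of the stress on the rim *)

Section Planar.
Variable R : realFieldType.
Implicit Types (x y xi : 'I_5 -> R) (M : 'I_5 -> 'I_5 -> R).

Lemma stress_star (M : 'I_5 -> 'I_5 -> R) x y xi (f g : R) :
  let det i j := x i * y j - y i * x j in
  let b i := f * y i - g * x i in
  (f != 0) || (g != 0) ->
  (forall i j, M i j = - M j i) ->
  (forall i, \sum_j M i j * xi j = 0) ->
  (forall i j, M i j != 0 -> xi i * b j = xi j * b i) ->
  (forall i j, 0 <= M i j * det i j) ->
  (forall i j, i != j -> det i j != 0) ->
  (forall i, exists j, M i j != 0) ->
  (forall i, xi (ordS i) != xi i) ->
  exists z, (forall j, j != z -> M j z != 0) /\
            (forall j k, j != z -> k != z -> M j k = 0).
Proof.
move=> det b fg0 anti kerM coll pos det0 nbr cyc.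
have n2 : 0 < f ^+ 2 + g ^+ 2.
  case/orP: fg0 => h.
    by rewrite ltr_pwDl ?sqr_ge0 // exprn_even_gt0.
  by rewrite ltr_wpDl ?sqr_ge0 // exprn_even_gt0.
have M0 i : M i i = 0 by move: (anti i i) => h; lra.
(* Up to scale, [a i] and [b i] are the components of the point along and across the direction
   [(f, g)]. *)
pose a i := f * x i + g * y i.
have detE i j : (f ^+ 2 + g ^+ 2) * det i j = a i * b j - a j * b i.
  by rewrite /det /a /b; ring.
(* Multiplied by [xi i], the sum turns under [coll] into [b i] times a row of [M] applied to [xi],
   which vanishes. *)
have bker i : xi i != 0 -> \sum_(j | xi j != 0) M i j * b j = 0.
  move=> xi0; apply: (mulfI xi0); rewrite mulr0 big_distrr /=.
  transitivity (\sum_(j | xi j != 0) b i * (M i j * xi j)).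
    apply: eq_bigr => j _; have [->|Mij] := eqVneq (M i j) 0.
      by rewrite !(mul0r, mulr0).
    by rewrite mulrCA (coll _ _ Mij); ring.
  rewrite -big_distrr /=; have := kerM i.
  rewrite (bigID (fun j => xi j != 0)) /= [X in _ + X]big1 ?addr0.
    by move->; rewrite mulr0.
  by move=> j /negPn/eqP->; rewrite mulr0.
(* [E] vanishes by [bker]. Adding to it the copy with [i] and [j] exchanged gives, by antisymmetry
   of [M] and [detE], a positive multiple of the energy. *)
have energy : \sum_(i | xi i != 0) \sum_(j | xi j != 0) M i j * det i j = 0.
  pose E := \sum_(i | xi i != 0) \sum_(j | xi j != 0) M i j * (a i * b j).
  have E0 : E = 0.
    apply: big1 => i /bker bi; transitivity (a i * \sum_(j | xi j != 0) M i j * b j).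
      by rewrite big_distrr /=; apply: eq_bigr => j _; rewrite mulrCA.
    by rewrite bi mulr0.
  have E' : E = \sum_(i | xi i != 0) \sum_(j | xi j != 0) M j i * (a j * b i).
    exact: exchange_big.
  apply: (mulfI (lt0r_neq0 n2)); rewrite mulr0; have : E + E = 0 by rewrite E0 addr0.
  rewrite {2}E' /E -big_split /= => EE; rewrite -[RHS]EE big_distrr /=.
  apply: eq_bigr => i _; rewrite big_distrr /= -big_split /=.
  by apply: eq_bigr => j _; rewrite mulrCA detE (anti j i); ring.
have indep i j : xi i != 0 -> xi j != 0 -> M i j = 0.
  move=> hi hj; have [->|ij] := eqVneq i j; first by rewrite M0.
  have /eqP := energy; rewrite psumr_eq0; last by move=> k _; apply: sumr_ge0.
  move/allP/(_ i (mem_index_enum _))/implyP/(_ hi).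
  rewrite psumr_eq0 //.
  move/allP/(_ j (mem_index_enum _))/implyP/(_ hj).
  by rewrite mulf_eq0 (negbTE (det0 _ _ ij)) orbF => /eqP.
have bzero i j : xi i != 0 -> xi j = 0 -> M i j != 0 -> b j = 0.
  by move=> hi hj /coll /eqP; rewrite hj mul0r mulf_eq0 (negbTE hi) /= => /eqP.
(* Two points with [b = 0] lie on one line through the origin, so their determinant vanishes. *)
have buniq i j : b i = 0 -> b j = 0 -> i = j.
  move=> bi bj; apply/eqP; apply: contraT => /det0.
  move: (detE i j); rewrite bi bj !mulr0 subrr => /eqP.
  by rewrite mulf_eq0 (negbTE (lt0r_neq0 n2)) /= => ->.
have [i0 hi0] : exists i, xi i != 0.
  have [h|h] := eqVneq (xi ord0) 0; last by exists ord0.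
  by exists (ordS ord0); rewrite -h.
have nbrN i : xi i != 0 -> exists2 j, M i j != 0 & xi j = 0 /\ b j = 0.
  move=> hi; have [j hj] := nbr i; exists j => //.
  have hj0 : xi j = 0.
    by apply/eqP; apply: contraT => /(indep _ _ hi)/eqP; rewrite (negbTE hj).
  by split=> //; apply: bzero hi hj0 hj.
have [z _ [xz bz]] := nbrN _ hi0.
(* If [xi k] is nonzero, [b j] vanishes and [j] would be [z]. Otherwise, were [k] not [z], then [xi]
   would vanish at the three distinct labels [j], [k], [z], two of which are cyclically
   consecutive. *)
have nbrF j k : j != z -> xi j = 0 -> M j k != 0 -> k = z.
  move=> jz xj Mjk.
  have [xk|xk] := eqVneq (xi k) 0; last first.
    have bj : b j = 0 by apply: (bzero k) => //; rewrite anti oppr_eq0.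
    by move/eqP: jz; case; apply: buniq.
  apply/eqP; apply: contraT => kz.
  have jk : j != k by apply: contraNneq Mjk => ->; rewrite M0.
  have [c [d [hc hd dE]]] := ordS5_three jk jz kz.
  have x0 m : m \in [:: j; k; z] -> xi m = 0.
    by rewrite !inE => /or3P[] /eqP->.
  by have := cyc c; rewrite -dE !x0 ?eqxx.
exists z; split=> [j jz|j k jz kz].
  have [xj|/nbrN[k Mjk [xk bk]]] := eqVneq (xi j) 0; last by rewrite (buniq z k).
  by have [k Mjk] := nbr j; rewrite -(nbrF j k).
apply/eqP; apply: contraT => Mjk; exfalso.
have [xj|hj] := eqVneq (xi j) 0; first by move/eqP: kz; apply; apply: nbrF Mjk.
have [xk|hk] := eqVneq (xi k) 0.
  by move/eqP: jz; apply; apply: (nbrF k) => //; rewrite anti oppr_eq0.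
by move/eqP: Mjk; apply; apply: indep.
Qed.

(** * Stars whose centre and [e] lie on a horizontal line *)

(** The larger of [a], [b] and the larger of [c], [d] both exceed 1/2, so their sum exceeds 1. *)
Lemma spread_sum_not_lt1 (a b c d : R) : 0 <= a -> 0 <= b -> 0 <= c -> 0 <= d ->
  2^-1 < `|a - b| -> 2^-1 < `|c - d| ->
  ~ [/\ a + c < 1, a + d < 1, b + c < 1 & b + d < 1].
Proof.
move=> a0 b0 c0 d0; rewrite !ltr_normr => /orP[] ? /orP[] ? [? ? ? ?]; lra.
Qed.

Lemma midpoint_of_tight (u d : R) : `|1 - u| = d -> `|u| = d -> u = 2^-1 /\ d = 2^-1.
Proof.
by case: (ler0P (1 - u)) => ?; case: (ler0P u) => ? ? ?; split; lra.
Qed.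

(** The expression is the determinant of the triangle [(w, 1/2)], [(a, 1)], [(b, 0)] and equals
    [w - (a + b) / 2]; for [w] in {0, 1} the bounds on [a] and [b] leave only one sign possible. *)
Lemma apex_sum (a b w : R) : 0 <= a <= 1 -> 0 <= b <= 1 ->
  2^-1 < `|(a - w) * - 2^-1 - (1 - 2^-1) * (b - w)| ->
  (w = 1 -> a + b < 1) /\ (w = 0 -> 1 < a + b).
Proof.
by rewrite ltr_normr => /andP[? ?] /andP[? ?] /orP[] ?; split=> ?; subst w; lra.
Qed.

Definition det3 x y (i j k : 'I_5) : R :=
  (x j - x i) * (y k - y i) - (y j - y i) * (x k - x i).

(** No three leaves are collinear, so each horizontal wall carries exactly two. The tight spokes
    then force [ye = d = 1/2], and the strict triangles on two leaves and a third point contradict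
    [spread_sum_not_lt1]. *)
Lemma no_axis_parallel_star x y (xe ye d : R) (z : 'I_5) :
  (forall i, 0 <= x i <= 1) -> y z = ye ->
  (forall j, j != z -> y j = 0 \/ y j = 1) ->
  (forall j, j != z -> `|(x z - xe) * (y j - ye)| = d) ->
  (x z = 1 /\ xe = 0) \/ (x z = 0 /\ xe = 1) ->
  (forall i j k, i != j -> i != k -> j != k -> d < `|det3 x y i j k|) ->
  False.
Proof.
move=> x01 yz walls tightz xz strict.
have d0 : 0 <= d.
  by have [j jz] : exists j, j != z; [exists (lift z ord0); rewrite eq_sym neq_lift
    | rewrite -(tightz j jz)].
have noncoll i j k : i != j -> i != k -> j != k -> y i = y j -> y i = y k -> False.
  move=> ij ik jk eij eik; have := strict i j k ij ik jk.
  by rewrite /det3 -eij -eik subrr mulr0 mul0r subr0 normr0 ltNge d0.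
have sides a b c e : [/\ a != z, b != z, c != z & e != z] -> a != b -> c != e ->
    a != c -> a != e -> b != c -> b != e ->
    y a = 1 -> y b = 1 -> y c = 0 -> y e = 0 -> False.
  move=> [az bz cz ez] ab ce ac ae bc be ya yb yc ye'.
  have := (tightz a az, tightz c cz); rewrite ya yc => -[ta tc].
  have S2 := strict a b c ab ac bc; have S3 := strict c e a ce.
  (* A triangle with base on one horizontal wall and apex on the other has height 1, so its
     determinant is the base length. *)
  have {}S2 : d < `|x a - x b|.
    by move: S2; rewrite /det3 ya yb yc; congr (_ < `|_|); ring.
  have {}S3 : d < `|x c - x e|.
    move: S3; rewrite eq_sym => /(_ ac); rewrite eq_sym => /(_ ae).
    by rewrite /det3 ya yc ye' -normrN; congr (_ < `|_|); ring.
  (* Since [z] and [e] are at horizontal distance 1, the spokes to a leaf on each wall give [d] as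
     the distance of [ye] from 1 and from 0. *)
  have [{}ye2 d2] : ye = 2^-1 /\ d = 2^-1.
    by apply: midpoint_of_tight; [rewrite -ta | rewrite -tc];
      case: xz => -[-> ->]; rewrite normrM ?subr0 ?sub0r ?normrN normr1 mul1r.
  have T p q : p != z -> q != z -> p != q -> y p = 1 -> y q = 0 ->
      (x z = 1 -> x p + x q < 1) /\ (x z = 0 -> 1 < x p + x q).
    move=> pz qz pq yp yq; apply: apex_sum => //.
    have := strict z p q; rewrite eq_sym pz eq_sym qz pq => /(_ isT isT isT).
    by rewrite /det3 yp yq sub0r yz ye2 d2.
  have [T1 T1'] := T a c az cz ac ya yc; have [T2 T2'] := T a e az ez ae ya ye'.
  have [T3 T3'] := T b c bz cz bc yb yc; have [T4 T4'] := T b e bz ez be yb ye'.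
  move: (x01 a) (x01 b) (x01 c) (x01 e) S2 S3; rewrite d2.
  move=> /andP[a0 a1] /andP[b0 b1] /andP[c0 c1] /andP[e0 e1] S2 S3.
  case: xz => -[xz1 _]; first by
    apply: (@spread_sum_not_lt1 (x a) (x b) (x c) (x e)) => //; split; auto.
  (* For [z] on the wall [x = 0], the reflection of [x] to [1 - x] gives the previous case. *)
  apply: (@spread_sum_not_lt1 (1 - x a) (1 - x b) (1 - x c) (1 - x e));
    rewrite ?subr_ge0 //.
  - by rewrite (_ : _ - _ = x b - x a) 1?distrC //; ring.
  - by rewrite (_ : _ - _ = x e - x c) 1?distrC //; ring.
  by move: (T1' xz1) (T2' xz1) (T3' xz1) (T4' xz1); clear; split; lra.
have lz (k : 'I_4) : lift z k != z by rewrite eq_sym neq_lift.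
have ll (k l : 'I_4) : k != l -> lift z k != lift z l by rewrite (inj_eq lift_inj).
pose l (k : nat) := lift z (inord k : 'I_4).
have {}lz k : l k != z by exact: lz.
have {}ll (i j : nat) : (i < 4)%N -> (j < 4)%N -> i != j -> l i != l j.
  by move=> i4 j4 ij; apply: ll; rewrite -val_eqE /= !inordK.
have N i j k : (i < 4)%N -> (j < 4)%N -> (k < 4)%N -> i != j -> i != k -> j != k ->
   y (l i) = y (l j) -> y (l i) = y (l k) -> False.
  by move=> *; apply: (noncoll (l i) (l j) (l k)); rewrite ?ll.
have [w ww] : exists w : nat -> bool, forall k, y (l k) = (w k)%:R.
  exists (fun k => y (l k) == 1) => k.
  by case: (walls _ (lz k)) => ->; rewrite ?eqxx // eq_sym oner_eq0.
have S a b c e : uniq [:: a; b; c; e] -> all (fun i => i < 4)%N [:: a; b; c; e] ->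
    [&& w a, w b, ~~ w c & ~~ w e] -> False.
  rewrite /= !inE !negb_or => /and4P[/and3P[? ? ?] /andP[? ?] ? _] /and5P[? ? ? ? _].
  case/and4P=> wa wb /negbTE wc /negbTE we.
  by apply: (sides (l a) (l b) (l c) (l e)); rewrite ?ll ?ww ?wa ?wb ?wc ?we //; split.
have {}N i j k : uniq [:: i; j; k] -> all (fun i => i < 4)%N [:: i; j; k] ->
    (w i == w j) && (w i == w k) -> False.
  rewrite /= !inE !negb_or => /and3P[/andP[? ?] ? _] /and4P[? ? ? _].
  case/andP=> /eqP e1 /eqP e2.
  by apply: (N i j k); rewrite ?ww -?e1 -?e2.
(* In each of the sixteen assignments of four leaves to two walls, either three leaves share a wall
   ([N]) or the split is two against two ([S]). *)
have := (N 0 1 2 isT isT, N 0 1 3 isT isT, N 0 2 3 isT isT, N 1 2 3 isT isT)%N.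
have := (S 0 1 2 3 isT isT, S 0 2 1 3 isT isT, S 0 3 1 2 isT isT,
         S 1 2 0 3 isT isT, S 1 3 0 2 isT isT, S 2 3 0 1 isT isT)%N.
clear; case: (w 0%N); case: (w 1%N); case: (w 2%N); case: (w 3%N) => /=;
  by move=> -[[[[[? ?] ?] ?] ?] ?] -[[[? ?] ?] ?]; auto using isT.
Qed.

(* F is a component of the outward reaction at a point of [0, 1]^2 and c the
   corresponding coordinate of the point. *)
Definition wall_force (c F : R) : Prop := (0 < F -> c = 1) /\ (F < 0 -> c = 0).

Lemma wall_force_neq0 c F : wall_force c F -> F != 0 -> c = 0 \/ c = 1.
Proof. by move=> [F1 F0]; rewrite neq_lt => /orP[/F0|/F1]; [left|right]. Qed.

(** * Equilibrium of a star-shaped stress in the square *)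

Section Star.
Variables (M : 'I_5 -> 'I_5 -> R) (x y X Y : 'I_5 -> R) (xe ye Xe d : R).
Variable z : 'I_5.
Let det i j := (x i - xe) * (y j - ye) - (y i - ye) * (x j - xe).
Hypothesis anti : forall i j, M i j = - M j i.
Hypothesis pos : forall i j, 0 <= M i j * det i j.
Hypothesis spokes : forall j, j != z -> M j z != 0.
Hypothesis leaves : forall j k, j != z -> k != z -> M j k = 0.
Hypothesis d_gt0 : 0 < d.
Hypothesis tight_spoke : forall j, j != z -> `|det z j| = d.
Hypothesis strict :
  forall i j k, i != j -> i != k -> j != k -> d < `|det3 x y i j k|.
Hypothesis eqx : forall i, \sum_j M i j * (x j - xe) = - (2 * Y i).
Hypothesis eqy : forall i, \sum_j M i j * (y j - ye) = 2 * X i.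
Hypothesis wallX : forall i, wall_force (x i) (X i).
Hypothesis wallY : forall i, wall_force (y i) (Y i).

Let leaf_sum (u : 'I_5 -> R) j : j != z -> \sum_k M j k * u k = M j z * u z.
Proof.
move=> jz; rewrite (bigD1 z) //= big1 ?addr0 // => k kz.
by rewrite leaves // mul0r.
Qed.

(** At a leaf the vertical reaction is nonzero, so the leaf lies on a horizontal wall. The
    horizontal reactions at [z] and [e] are opposite and point away from each other, which puts the
    two points on opposite vertical walls. *)
Lemma star_not_horizontal :
  (forall i, 0 <= x i <= 1) ->
  \sum_j (\sum_k M j k) * (y j - ye) = 2 * Xe -> wall_force xe Xe ->
  y z <> ye.
Proof.
move=> x01 eqe wallXe yz.
have detz j : det z j = (x z - xe) * (y j - ye).
  by rewrite /det yz subrr mul0r subr0.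
have xz0 : x z - xe != 0.
  apply: contraTneq d_gt0 => xz0; have jz : lift z ord0 != z by rewrite eq_sym neq_lift.
  by rewrite -(tight_spoke jz) detz xz0 mul0r normr0 ltxx.
(* Twice the product is the sum of the [M z j * det z j]: no term is negative, and every spoke
   contributes a positive one. *)
have push : 0 < (x z - xe) * X z.
  rewrite -(pmulr_rgt0 _ (ltr0n R 2)) mulrCA -eqy big_distrr /=.
  have term j : (x z - xe) * (M z j * (y j - ye)) = M z j * det z j.
    by rewrite detz mulrCA.
  rewrite (eq_bigr _ (fun j _ => term j)).
  have jz : lift z ord0 != z by rewrite eq_sym neq_lift.
  rewrite (bigD1 (lift z ord0)) //= ltr_pwDl ?sumr_ge0 //.
  rewrite lt_neqAle pos andbT eq_sym mulf_neq0 //.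
    by rewrite anti oppr_eq0 spokes.
  by rewrite -normr_gt0 tight_spoke.
(* At a leaf [j] the row sum of [M] is [M j z = - M z j], and the term of [z] is zero because
   [y z = ye]. *)
have XeE : Xe = - X z.
  have two0 : (2 : R) != 0 by rewrite pnatr_eq0.
  apply: (mulfI two0); rewrite mulrN -eqe -eqy -sumrN; apply: eq_bigr => j _.
  have [->|jz] := eqVneq j z; first by rewrite yz subrr !mulr0 oppr0.
  rewrite -mulNr -anti; congr (_ * _).
  have := leaf_sum (fun=> 1) jz; rewrite mulr1 => <-.
  by apply: eq_bigr => k _; rewrite mulr1.
apply: (@no_axis_parallel_star x y xe ye d z) => // [j jz|j jz|].
- apply: wall_force_neq0 (wallY j) _.
  have := eqx j; rewrite leaf_sum // => h.
  apply: contraTneq (mulf_neq0 (spokes jz) xz0).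
  by move=> Y0; rewrite h Y0 mulr0 oppr0 eqxx.
- by rewrite -detz tight_spoke.
move: wallXe (wallX z); rewrite XeE /wall_force oppr_gt0 oppr_lt0 => -[e1 e0] [z1 z0].
have [xlt|xgt|/eqP] := ltgtP (x z - xe) 0; last by rewrite (negbTE xz0).
  by move: push; rewrite nmulr_rgt0 // => F; right; rewrite z0 ?e1.
by move: push; rewrite pmulr_rgt0 // => F; left; rewrite z1 ?e0.
Qed.

(** Both components of the reaction at a leaf [j] are nonzero multiples of [M j z], so the sign of
    [M j z] determines the corner occupied by [j]. Among three leaves two signs agree; these leaves
    coincide and span a degenerate triangle. *)
Lemma star_not_oblique : x z <> xe -> y z <> ye -> False.
Proof.
move=> /eqP; rewrite -subr_eq0 => p0 /eqP; rewrite -subr_eq0 => q0.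
have samepos j k (s := M j z * M k z) : j != z -> k != z -> 0 < s ->
    x j = x k /\ y j = y k.
  move=> jz kz s0.
  have same c c' F F' m : m != 0 -> wall_force c F -> wall_force c' F' ->
      F = m * M j z -> F' = m * M k z -> c = c'.
    move=> m0 [F1 F0] [F1' F0'] FE FE'.
    have FF : 0 < F * F'.
      by rewrite FE FE' mulrACA mulr_gt0 // -expr2 exprn_even_gt0.
    have [/[dup] Flt /F0 ->|/[dup] Fgt /F1 ->|F00] := ltgtP F 0.
    - by rewrite F0' //; move: FF; rewrite nmulr_rgt0.
    - by rewrite F1' //; move: FF; rewrite pmulr_rgt0.
    by move: FF; rewrite F00 mul0r ltxx.
  have two0 : (2 : R) != 0 by rewrite pnatr_eq0.
  have hX i : i != z -> X i = (y z - ye) / 2 * M i z.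
    move=> iz; have := eqy i; rewrite leaf_sum // => h.
    by rewrite mulrAC [_ * M i z]mulrC h mulrC mulKf.
  have hY i : i != z -> Y i = - ((x z - xe) / 2) * M i z.
    move=> iz; have := eqx i; rewrite leaf_sum // => h.
    by rewrite mulNr mulrAC [_ * M i z]mulrC h mulNr opprK mulrC mulKf.
  split.
    apply: (same _ _ _ _ _ _ (wallX j) (wallX k) (hX j jz) (hX k kz)).
    by rewrite mulf_neq0 ?invr_eq0.
  apply: (same _ _ _ _ _ _ (wallY j) (wallY k) (hY j jz) (hY k kz)).
  by rewrite oppr_eq0 mulf_neq0 ?invr_eq0.
have key i j k : i != z -> j != z -> i != j -> i != k -> j != k -> ~ 0 < M i z * M j z.
  move=> iz jz ij ik jk /(samepos i j iz jz)[xij yij].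
  have := strict ij ik jk; rewrite /det3 xij yij !subrr !mul0r subrr normr0.
  by move=> /(lt_trans d_gt0); rewrite ltxx.
pose l (k : nat) := lift z (inord k : 'I_4).
have lz k : l k != z by rewrite eq_sym neq_lift.
have ll (i j : nat) : (i < 4)%N -> (j < 4)%N -> i != j -> l i != l j.
  by move=> i4 j4 ij; rewrite (inj_eq lift_inj) -val_eqE /= !inordK.
have K i j k : uniq [:: i; j; k] -> all (fun i => i < 4)%N [:: i; j; k] ->
    ~ 0 < M (l i) z * M (l j) z.
  rewrite /= !inE !negb_or => /and3P[/andP[? ?] ? _] /and4P[? ? ? _].
  by apply: (key _ _ (l k)); rewrite ?ll.
have := (K 0 1 2 isT isT, K 0 2 1 isT isT, K 1 2 0 isT isT)%N => -[[K1 K2] K3].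
have sgn i : M (l i) z != 0 by apply: spokes.
have := sgn 0%N; rewrite neq_lt => /orP[s0|s0];
have := sgn 1%N; rewrite neq_lt => /orP[s1|s1];
have := sgn 2%N; rewrite neq_lt => /orP[s2|s2];
first [by apply: K1; rewrite nmulr_rgt0 | by apply: K1; rewrite pmulr_rgt0
  | by apply: K2; rewrite nmulr_rgt0 | by apply: K2; rewrite pmulr_rgt0
  | by apply: K3; rewrite nmulr_rgt0 | by apply: K3; rewrite pmulr_rgt0].
Qed.

End Star.

Lemma no_star_equilibrium (M : 'I_5 -> 'I_5 -> R) (x y X Y : 'I_5 -> R)
    (xe ye Xe Ye d : R) (z : 'I_5) :
  let det i j := (x i - xe) * (y j - ye) - (y i - ye) * (x j - xe) in
  (forall i j, M i j = - M j i) ->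
  (forall i j, 0 <= M i j * det i j) ->
  (forall j, j != z -> M j z != 0) ->
  (forall j k, j != z -> k != z -> M j k = 0) ->
  0 < d ->
  (forall j, j != z -> `|det z j| = d) ->
  (forall i j k, i != j -> i != k -> j != k -> d < `|det3 x y i j k|) ->
  (forall i, \sum_j M i j * (x j - xe) = - (2 * Y i)) ->
  (forall i, \sum_j M i j * (y j - ye) = 2 * X i) ->
  \sum_j (\sum_k M j k) * (x j - xe) = - (2 * Ye) ->
  \sum_j (\sum_k M j k) * (y j - ye) = 2 * Xe ->
  (forall i, wall_force (x i) (X i)) -> (forall i, wall_force (y i) (Y i)) ->
  wall_force xe Xe -> wall_force ye Ye ->
  (forall i, 0 <= x i <= 1) -> (forall i, 0 <= y i <= 1) ->
  False.
Proof.
move=> det anti pos spokes leaves d0 tightz strict eqx eqy eqxe eqye wX wY wXe wYe x01 y01.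
have yz : y z <> ye by apply: (@star_not_horizontal M x y X Y xe ye Xe d).
have xz : x z <> xe.
  (* The reflection in x = y negates determinants, hence also the stress. *)
  apply: (@star_not_horizontal (fun i j => - M i j) y x Y X ye xe Ye d) => //.
  - by move=> i j; rewrite anti.
  - by move=> i j; rewrite (_ : _ * _ = M i j * det i j) //; rewrite /det; ring.
  - by move=> j /spokes; rewrite oppr_eq0.
  - by move=> j k jz kz; rewrite leaves // oppr0.
  - by move=> j /tightz <-; rewrite -normrN; congr (`|_|); rewrite /det; ring.
  - move=> i j k ij ik jk; have := strict i j k ij ik jk.
    by rewrite -normrN /det3; congr (_ < `|_|); ring.
  - by move=> i; rewrite -eqy -sumrN; apply: eq_bigr => j _; rewrite mulNr.
  - move=> i; apply: oppr_inj; rewrite -eqx -sumrN; apply: eq_bigr => j _.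
    by rewrite mulNr opprK.
  apply: oppr_inj; rewrite -eqxe -sumrN; apply: eq_bigr => j _.
  by rewrite sumrN mulNr opprK.
exact: (@star_not_oblique M x y X Y xe ye d z).
Qed.
End Planar.

(** * Derivatives of areas and entries of the stress *)

Section Area.
Variables (R : realType) (n : nat).
Implicit Types (P v : config R n) (t : triple n).

Lemma det_mx2 (A : 'M[R]_2) : \det A = A 0 0 * A 1 1 - A 0 1 * A 1 0.
Proof.
rewrite (expand_det_row _ 0) big_ord_recl big_ord1 /cofactor !det_mx11 !mxE /=.
rewrite expr0 expr1 mul1r mulN1r mulrN.
by congr (_ * A _ _ - A _ _ * A _ _); apply: val_inj.
Qed.

Lemma D3E P i j k : D3 P i j k =
  (P j xcoord - P i xcoord) * (P k ycoord - P i ycoord)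
  - (P j ycoord - P i ycoord) * (P k xcoord - P i xcoord).
Proof.
rewrite /D3 det_mx2; set A := row j P - _; set B := row k P - _.
have E0 c : (col_mx A B : 'M[R]_2) 0 c = A 0 c.
  by rewrite -(col_mxEu A B); congr (col_mx A B _ c); apply: val_inj.
have E1 c : (col_mx A B : 'M[R]_2) 1 c = B 0 c.
  by rewrite -(col_mxEd A B); congr (col_mx A B _ c); apply: val_inj.
by rewrite !E0 !E1 !mxE.
Qed.

(** The differential of [D3] at [P] in the direction [v]. *)
Definition D3_diff P v (i j k : 'I_n) : R :=
  (v j xcoord - v i xcoord) * (P k ycoord - P i ycoord)
  - (v j ycoord - v i ycoord) * (P k xcoord - P i xcoord)
  + (P j xcoord - P i xcoord) * (v k ycoord - v i ycoord)
  - (P j ycoord - P i ycoord) * (v k xcoord - v i xcoord).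

(** Along a line [Dt] is a quadratic polynomial [D + h L + h^2 Q] whose sign is constant near
    [h = 0], so the difference quotient of the area is there exactly [s (L + h Q) / 2]. *)
Lemma DA_eq t P v : Dt t P != 0 ->
  DA t P v = 2^-1 * (Num.sg (Dt t P) * D3_diff P v (tri1 t) (tri2 t) (tri3 t)).
Proof.
move=> D0; set D := Dt t P; set L := D3_diff _ _ _ _ _; set s := Num.sg D.
pose Q := D3 v (tri1 t) (tri2 t) (tri3 t).
have DtE h : Dt t (h *: v + P) = D + h * L + h ^+ 2 * Q.
  by rewrite /D /Dt /Q /L /D3_diff !D3E !mxE; ring.
have cont (a b c : R) : (fun h : R => a + h * b + h ^+ 2 * c) @ 0^' --> a.
  have : {for (0 : R), continuous (fun h : R => a + h * b + h ^+ 2 * c)}.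
    by move=> h; apply: cvgD; [apply: cvgD; [exact: cvg_cst|]|];
      apply: cvgM; try exact: cvg_cst; try exact: cvg_id; apply: exprn_continuous.
  move/continuous_withinNx; rewrite mul0r expr0n /= mul0r !addr0; exact.
apply: cvg_lim => //.
have near_sg : \forall h \near (0 : R)^', `|Dt t (h *: v + P)| = s * Dt t (h *: v + P).
  have : \forall h \near (0 : R)^', 0 < s * Dt t (h *: v + P).
    have c := cont (s * D) (s * L) (s * Q).
    have sD : 0 < s * D by rewrite /s -normrEsg normr_gt0.
    apply: filterS (cvgr_gt _ c _ sD) => h; rewrite DtE => h0.
    by rewrite (_ : _ * _ = s * D + h * (s * L) + h ^+ 2 * (s * Q)) //; ring.
  apply: filterS => h h0; have := gtr0_norm h0.
  by rewrite normrM normr_sg D0 mul1r.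
have c := cont (2^-1 * (s * L)) (2^-1 * (s * Q)) 0.
apply: cvg_trans c; apply: near_eq_cvg; near=> h.
have h0 : h != 0 by near: h; exact: nbhs_dnbhs_neq.
rewrite /= /area (near near_sg h) // [`|Dt t P|]normrEsg -/D -/s DtE /GRing.scale /=.
by field.
Unshelve. all: by end_near. Qed.

Lemma D3_diff_eq0 t P v : Dt t P != 0 -> DA t P v = 0 ->
  D3_diff P v (tri1 t) (tri2 t) (tri3 t) = 0.
Proof.
move=> D0 /eqP; rewrite DA_eq // !mulf_eq0 invr_eq0 pnatr_eq0 sgr_eq0 /=.
by rewrite (negbTE D0) => /eqP.
Qed.

Lemma tri_ltn t : (tri1 t < tri2 t)%N /\ (tri2 t < tri3 t)%N.
Proof. by case/andP: (valP t). Qed.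

(** A triple stores its labels in increasing order, whereas [i], [j], [k] come in any order; this
    view splits into the six possibilities. *)
Variant perm3_spec (T : eqType) (i j k : T) : T -> T -> T -> Prop :=
| Perm3_ijk : perm3_spec i j k i j k
| Perm3_jki : perm3_spec i j k j k i
| Perm3_kij : perm3_spec i j k k i j
| Perm3_ikj : perm3_spec i j k i k j
| Perm3_jik : perm3_spec i j k j i k
| Perm3_kji : perm3_spec i j k k j i.

Lemma verts_perm3 t i j k : i != j -> i != k -> j != k ->
  verts t = [set i; j; k]%SET -> perm3_spec i j k (tri1 t) (tri2 t) (tri3 t).
Proof.
move=> ij ik jk E; have [l12 l23] := tri_ltn t.
have n12 : tri1 t != tri2 t by rewrite -val_eqE neq_ltn l12.
have n23 : tri2 t != tri3 t by rewrite -val_eqE neq_ltn l23.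
have n13 : tri1 t != tri3 t by rewrite -val_eqE neq_ltn (ltn_trans l12 l23).
have h1 : tri1 t \in [set i; j; k]%SET by rewrite -E !inE eqxx.
have h2 : tri2 t \in [set i; j; k]%SET by rewrite -E !inE eqxx orbT.
have h3 : tri3 t \in [set i; j; k]%SET by rewrite -E !inE eqxx !orbT.
move: h1 h2 h3 n12 n23 n13; rewrite !inE -!orbA.
by do 3![case/or3P => /eqP->]; rewrite ?eqxx // => *; constructor.
Qed.

Lemma triple_of (i j k : 'I_n) : i != j -> i != k -> j != k ->
  exists t, verts t = [set i; j; k]%SET.
Proof.
have sorted (a b c : 'I_n) : (a < b)%N -> (b < c)%N ->
    exists t, verts t = [set a; b; c]%SET.
  move=> ab bc; have h : (a < b)%N && (b < c)%N by rewrite ab.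
  by exists (exist _ (a, b, c) h).
have perm (a b c : 'I_n) : (a < b)%N -> (b < c)%N ->
    [set i; j; k]%SET = [set a; b; c]%SET -> exists t, verts t = [set i; j; k]%SET.
  by move=> ab bc ->; apply: sorted.
rewrite -!val_eqE !neq_ltn.
case/orP=> ij /orP[] ik /orP[] jk.
- exact: (perm i j k).
- by apply: (perm i k j) => //; apply/setP => x; rewrite !inE; do 3![case: (x == _)].
- by have := ltn_trans (ltn_trans ij jk) ik; rewrite ltnn.
- by apply: (perm k i j) => //; apply/setP => x; rewrite !inE; do 3![case: (x == _)].
- by apply: (perm j i k) => //; apply/setP => x; rewrite !inE; do 3![case: (x == _)].
- by have := ltn_trans (ltn_trans ik jk) ij; rewrite ltnn.
- by apply: (perm j k i) => //; apply/setP => x; rewrite !inE; do 3![case: (x == _)].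
by apply: (perm k j i) => //; apply/setP => x; rewrite !inE; do 3![case: (x == _)].
Qed.

Lemma normD3_verts P t i j k : i != j -> i != k -> j != k ->
  verts t = [set i; j; k]%SET -> `|Dt t P| = `|D3 P i j k|.
Proof.
move=> ij ik jk /(verts_perm3 ij ik jk); rewrite /Dt.
by case; rewrite !D3E; first [congr `|_|; ring | rewrite -normrN; congr `|_|; ring].
Qed.

Lemma D3_diff_verts P v t i j k : i != j -> i != k -> j != k ->
  verts t = [set i; j; k]%SET ->
  D3_diff P v (tri1 t) (tri2 t) (tri3 t) = 0 -> D3_diff P v i j k = 0.
Proof.
move=> ij ik jk /(verts_perm3 ij ik jk); rewrite /D3_diff.
by case=> h; first [rewrite -[RHS]h; ring | rewrite -[RHS]oppr0 -[in RHS]h; ring].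
Qed.

Lemma Bt_entry P t i j : Bt P t i j = Num.sg (Dt t P) *
  ((((i == tri2 t)%:R - (i == tri1 t)%:R) * ((j == tri3 t)%:R - (j == tri1 t)%:R))
   - (((i == tri3 t)%:R - (i == tri1 t)%:R) * ((j == tri2 t)%:R - (j == tri1 t)%:R))).
Proof.
by rewrite /Bt !mxE !big_ord1 !mxE !eqxx !andbT.
Qed.

(** An odd reordering of the vertices changes the sign of both [Dt] and the antisymmetric matrix, so
    the stored order is immaterial. *)
Lemma Bt_verts P t i j k : i != j -> i != k -> j != k ->
  verts t = [set i; j; k]%SET -> Bt P t i j = Num.sg (D3 P i j k).
Proof.
move=> ij ik jk /(verts_perm3 ij ik jk); rewrite Bt_entry /Dt.
have [ji [ki kj]] : j != i /\ k != i /\ k != j by rewrite eq_sym ij eq_sym ik eq_sym jk.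
by case; rewrite ?eqxx ?(negbTE ij) ?(negbTE ik) ?(negbTE jk) ?(negbTE ji)
  ?(negbTE ki) ?(negbTE kj) /=;
  first [rewrite (_ : _ - _ = 1); [rewrite mulr1 | ring]
        | rewrite (_ : _ - _ = -1); [rewrite mulrN1 -sgrN | ring]];
  congr Num.sg; rewrite !D3E; ring.
Qed.

Lemma Bt_notin P t i j : i \notin verts t -> Bt P t i j = 0.
Proof.
rewrite Bt_entry !inE !negb_or -andbA => /and3P[/negbTE-> /negbTE-> /negbTE->].
by rewrite subr0 !mul0r subr0 mulr0.
Qed.

Lemma Bt_anti P t i j : Bt P t i j = - Bt P t j i.
Proof. by rewrite !Bt_entry; ring. Qed.

Lemma Bt_row_sum P t i : \sum_j Bt P t i j = 0.
Proof.
have one (a : 'I_n) : \sum_j ((j == a)%:R : R) = 1.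
  by rewrite (bigD1 a) //= eqxx big1 ?addr0 // => j /negbTE->.
under eq_bigr do rewrite Bt_entry.
by rewrite -big_distrr /= sumrB -!big_distrr /= !sumrB !one !subrr !mulr0 subrr mulr0.
Qed.

Variables (q : constr n -> R) (P : config R n).

Lemma stress_entry i j : stress P q i j = \sum_t q (Tri t) * Bt P t i j.
Proof. by rewrite /stress summxE; apply: eq_bigr => t _; rewrite mxE. Qed.

Lemma stress_anti i j : stress P q i j = - stress P q j i.
Proof.
by rewrite !stress_entry -sumrN; apply: eq_bigr => t _; rewrite Bt_anti mulrN.
Qed.

Lemma stress_row_sum i : \sum_j stress P q i j = 0.
Proof.
under eq_bigr do rewrite stress_entry.
rewrite exchange_big big1 // => t _.
by rewrite -big_distrr /= Bt_row_sum mulr0.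
Qed.

End Area.

(** * Equilibrium by coordinates, and positive components *)

Section Component.
Variables (R : realType) (n : nat) (P : config R n) (q : constr n -> R).

(** Real and imaginary parts of [Bz = 2ib]; the factor [i] exchanges the two components of the
    reaction and negates the vertical one. *)
Lemma equilibrium_entry i : equilibrium P q ->
  \sum_j stress P q i j * P j xcoord = - (2 * (q (Up i) - q (Down i))) /\
  \sum_j stress P q i j * P j ycoord = 2 * (q (Right i) - q (Left i)).
Proof.
move=> /matrixP/(_ i 0); rewrite !mxE.
under eq_bigr do rewrite !mxE.
have -> : \sum_j (stress P q i j)%:C%C * (P j xcoord +i* P j ycoord)%C =
    ((\sum_j stress P q i j * P j xcoord) +i* (\sum_j stress P q i j * P j ycoord))%C.
  by elim/big_rec3: _ => // j a b c _ ->; simpc.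
rewrite -mulrA mulr_natl; simpc; rewrite mulr2n; simpc => -[-> ->].
by split; ring.
Qed.

Lemma verts_third (t : triple n) i j : i \in verts t -> j \in verts t -> i != j ->
  exists k, [/\ k != i, k != j & verts t = [set i; j; k]%SET].
Proof.
have [l12 l23] := tri_ltn t.
have n12 : tri1 t != tri2 t by rewrite -val_eqE neq_ltn l12.
have n23 : tri2 t != tri3 t by rewrite -val_eqE neq_ltn l23.
have n13 : tri1 t != tri3 t by rewrite -val_eqE neq_ltn (ltn_trans l12 l23).
have [n21 [n32 n31]] : tri2 t != tri1 t /\ tri3 t != tri2 t /\ tri3 t != tri1 t.
  by rewrite eq_sym n12 eq_sym n23 eq_sym n13.
rewrite /verts !inE -!orbA => /or3P[] /eqP-> /or3P[] /eqP-> ij; rewrite ?eqxx // in ij *;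
  [exists (tri3 t)|exists (tri2 t)|exists (tri3 t)
  |exists (tri1 t)|exists (tri2 t)|exists (tri1 t)];
  split=> //; apply/setP => x; rewrite !inE; do 3![case: (x == _)]; done.
Qed.

Variables (S : {set 'I_n}).
Hypothesis compS : positive_component q S.

Let hadj_sym : connect_sym (hadj q).
Proof.
apply: sym_connect_sym => i j /=.
by apply: eq_existsb => t; rewrite [(i \in _) && _]andbC.
Qed.

Lemma positive_component_closed t i : 0 < q (Tri t) -> i \in verts t -> i \in S ->
  verts t \subset S.
Proof.
case: compS => -[r ->] _ qt it; rewrite inE => ri; apply/fintype.subsetP => j jt.
rewrite inE; apply: connect_trans ri (connect1 _).
by apply/existsP; exists t; rewrite qt it.
Qed.

(** A path from [i] to a different label has a first step, and the triangle of that step contains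
    [i]. *)
Lemma positive_component_covered i j : i \in S -> j \in S -> i != j ->
  exists t, 0 < q (Tri t) /\ i \in verts t.
Proof.
case: compS => -[r ->] _; rewrite !inE hadj_sym => ir rj ij.
have /connectP[[|k p] /= hp jE] := connect_trans ir rj.
  by rewrite jE eqxx in ij.
by case/andP: hp => /existsP[t /and3P[qt it _]] _; exists t.
Qed.

Hypothesis q_ge0 : forall c, 0 <= q c.

Lemma stress_outside i j : i \in S -> j \notin S -> stress P q i j = 0.
Proof.
move=> iS jS; rewrite stress_entry big1 // => t _.
have := q_ge0 (Tri t); rewrite le0r => /orP[/eqP->|qt]; first by rewrite mul0r.
have [it|it] := boolP (i \in verts t); last by rewrite Bt_notin ?mulr0.
rewrite Bt_anti Bt_notin ?oppr0 ?mulr0 //.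
by apply: contra jS; move/fintype.subsetP: (positive_component_closed qt it iS); exact.
Qed.

End Component.

(** * Rim labels, hub and the further label [e] *)

Section Wheel.
Variable n : nat.
Variables (hn : (7 <= n)%N) (e : 'I_n).
Hypothesis eNcore : e \notin core_labels hn.
Let r := rim hn.

Lemma rim_inj : injective r.
Proof.
by move=> i j /(congr1 val) /= /eqP; rewrite eqSS => /eqP /val_inj.
Qed.

Lemma rim_core i : r i \in core_labels hn.
Proof. exact: imset_f. Qed.

Lemma rim_neq_e i : r i != e.
Proof. by apply: contraNneq eNcore => <-; apply: rim_core. Qed.

Lemma hub_neq_rim i : hub hn != r i.
Proof. by rewrite -val_eqE. Qed.

Lemma rim_triple_not_wheel (t : triple n) i j k m :
  verts t = [set r i; r j; r k]%SET -> verts t <> wheel_row hn m.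
Proof.
move=> -> /setP/(_ (hub hn)); rewrite !inE eqxx.
by rewrite !(negbTE (hub_neq_rim _)).
Qed.
End Wheel.

(* [word k] is the sign (true for +) of D(0, k+1, k+2), cyclically. *)
Theorem theorem8p3 (R : realType) (word : {ffun 'I_5 -> bool}) :
  ~ exists (n : nat) (hn : (7 <= n)%N) (P : config R n) (e : 'I_n)
           (f1 f2 : 'rV[R]_2) (v : config R n) (xi eta : 'cV[R]_n),
    (* the configuration, its labels and its orientation word *)
    [/\ in_square P, 0 < mindelta P, KKT P !=set0, e \notin core_labels hn &
        forall k : 'I_5,
          Num.sg (D3 P (hub hn) (rim hn k) (rim hn (ordS k)))
            = if word k then 1 else -1] /\
    (* C0 *)
    [/\ quotient_dim (Ksh P) <[ones R n]>%VS 2 /\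
          quotient_dim (Wnum P) (Ttr R n) 1,
        forall i : 'I_n, stress_silent P i <-> i = hub hn,
        basis_of fullv [:: f1; f2] /\
          (forall i : 'I_n, row i v = xi i 0 *: f1 + eta i 0 *: f2),
        represents_generator (Wnum P) (Ttr R n) v &
        row (hub hn) v = f2 /\
          (forall k : 'I_5, row (rim hn k) v = xi (rim hn k) 0 *: f1)] /\
    (* C1 *)
    (forall (k : 'I_5) (t : triple n), verts t = wheel_row hn k ->
       tight P t /\ unsupported P t) /\
    (* C2 *)
    (forall t : triple n, verts t \subset core_labels hn ->
       (forall k : 'I_5, verts t <> wheel_row hn k) -> mindelta P < area t P) /\
    (* C3 *)
    (forall k : 'I_5, xi (rim hn (ordS k)) 0 - xi (rim hn k) 0 <> 0) /\
    (* C4 *)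
    (forall k : 'I_5, ~ stress_silent P (rim hn k)) /\
    (* C5 *)
    ((forall t : triple n, tight P t -> DA t P v = 0) /\
     (forall q, KKT P q -> stress P q *m xi = 0 /\ stress P q *m eta = 0)) /\
    (* C6 *)
    ((exists2 q, relint (KKT P) q &
        positive_component q (e |: rim_labels hn)%SET) /\
     row e v = xi e 0 *: f1) /\
    (* C7 *)
    [/\ forall q, KKT P q -> equilibrium P q,
        forall q, KKT P q -> partial_moments P q,
        forall q, KKT P q -> wall_complementarity P q &
        (forall t : triple n, mindelta P <= area t P) /\ in_square P].
Proof.

(* Reduction of a configuration to a star on the rim *)
case=> n [hn [P [e [f1 [f2 [v [xi [eta]]]]]]]].
case=> -[sqP D0 _ eNcore _] [[_ _ [fbasis _] _ [_ vrim]]].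
case=> _ [strictC [cycC [_ [[tightDA kerB]]]]].
case=> -[[q qrel compS] ve] [equil _ _ [minA _]].
pose r := rim hn; pose S := (e |: rim_labels hn)%SET.
have rI : injective r := @rim_inj n hn.
have re i : r i != e := rim_neq_e eNcore i.
have [qK _] := qrel; have [q_ge0 qtight wall _ _] := qK.
have rS i : r i \in S by rewrite !inE imset_f ?orbT.
have eS : e \in S by rewrite !inE eqxx.
have tight_pos t : 0 < q (Tri t) -> tight P t.
  move=> qt; apply: contrapT => /qtight q0; by rewrite q0 ltxx in qt.
have strict_rim (t : triple n) i j k :
    verts t = [set r i; r j; r k]%SET -> mindelta P < area t P.
  move=> tE; apply: strictC => [|m]; last exact: rim_triple_not_wheel tE.
  rewrite tE; apply/fintype.subsetP => x; rewrite !inE -orbA.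
  by case/or3P => /eqP->; apply: rim_core.
have memS x : x \in S -> x != e -> exists k, x = r k.
  by rewrite !inE => /orP[/eqP->|/imsetP[k _ ->]]; [rewrite eqxx|exists k].
(* The triangle stays inside the component. If it avoided [e], all its vertices would be on the rim,
   and it would be both tight and strict. *)
have rim_tri t i : 0 < q (Tri t) -> r i \in verts t ->
    exists2 k, k != i & verts t = [set e; r i; r k]%SET.
  move=> qt it.
  have /fintype.subsetP sub := positive_component_closed compS qt it (rS i).
  have et : e \in verts t.
    apply: contraT => et.
    have mem x : x \in verts t -> exists k, x = r k.
      by move=> xt; apply: memS (sub x xt) _; apply: contraNneq et => <-.
    have h1 : tri1 t \in verts t by rewrite !inE eqxx.
    have h2 : tri2 t \in verts t by rewrite !inE eqxx orbT.
    have h3 : tri3 t \in verts t by rewrite !inE eqxx !orbT.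
    have [[k1 e1] [k2 e2] [k3 e3]] := And3 (mem _ h1) (mem _ h2) (mem _ h3).
    have : verts t = [set r k1; r k2; r k3]%SET by rewrite /verts e1 e2 e3.
    by move/strict_rim; rewrite (tight_pos _ qt) ltxx.
  have er : e != r i by rewrite eq_sym.
  have [x [xe xi' tE]] := verts_third et it er.
  have xS : x \in S by apply: sub; rewrite tE !inE eqxx orbT.
  have [k xk] := memS x xS xe; exists k; last by rewrite tE xk.
  by apply: contraNneq xi' => <-; rewrite xk.
pose M (i j : 'I_5) : R := stress P q (r i) (r j).
pose x (i : 'I_5) : R := P (r i) xcoord; pose y (i : 'I_5) : R := P (r i) ycoord.
pose xe := P e xcoord; pose ye := P e ycoord.
pose det i j := (x i - xe) * (y j - ye) - (y i - ye) * (x j - xe).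
have detE i j : det i j = D3 P e (r i) (r j) by rewrite D3E.
have anti i j : M i j = - M j i by exact: stress_anti.
have term t i j : i != j -> q (Tri t) * Bt P t (r i) (r j) = 0 \/
    0 < q (Tri t) /\ verts t = [set e; r i; r j]%SET.
  move=> ij; have := q_ge0 (Tri t); rewrite le0r => /orP[/eqP->|qt].
    by left; rewrite mul0r.
  have [it|it] := boolP (r i \in verts t); last by left; rewrite Bt_notin ?mulr0.
  have [jt|jt] := boolP (r j \in verts t); last first.
    by left; rewrite Bt_anti Bt_notin ?oppr0 ?mulr0.
  right; split=> //; have [k _ tE] := rim_tri t i qt it.
  rewrite tE; congr (_ :|: [set _])%SET.
  move: jt; rewrite tE !inE (negbTE (re j)) /= => /orP[/eqP/rI ji|/eqP->//].
  by rewrite ji eqxx in ij.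
(* The entry of [Bt] is the orientation sign of [(r i, r j, e)], which is that of [det i j]. *)
have Bt_spoke t i j : i != j -> verts t = [set e; r i; r j]%SET ->
    Bt P t (r i) (r j) * det i j = `|det i j|.
  move=> ij tE; rewrite (@Bt_verts _ _ P t (r i) (r j) e) ?(inj_eq rI) //.
    by rewrite normrEsg detE !D3E; congr (Num.sg _ * _); ring.
  by rewrite tE; apply/setP => z; rewrite !inE; do 3![case: (z == _)].
have term_ge0 t i j : i != j -> 0 <= q (Tri t) * Bt P t (r i) (r j) * det i j.
  move=> ij; have [->|[qt tE]] := term t i j ij; first by rewrite mul0r.
  by rewrite -mulrA Bt_spoke // mulr_ge0 // ltW.
have pos i j : 0 <= M i j * det i j.
  have [->|ij] := eqVneq i j.
    by rewrite (_ : det j j = 0) ?mulr0 // /det; ring.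
  by rewrite /M stress_entry mulr_suml sumr_ge0 // => t _; apply: term_ge0.
have edge i j : M i j != 0 -> i != j /\
    exists t, tight P t /\ verts t = [set e; r i; r j]%SET.
  move=> Mij; have ij : i != j.
    by apply: contraNneq Mij => ->; have := anti j j => h; apply/eqP; lra.
  split=> //; apply: contrapT => noT; move/eqP: Mij; apply.
  rewrite /M stress_entry big1 // => t _; have [//|[qt tE]] := term t i j ij.
  by case: noT; exists t; split=> //; apply: tight_pos.
have erN i : e != r i by rewrite eq_sym.
have areaE t i j : i != j -> verts t = [set e; r i; r j]%SET ->
    area t P = 2^-1 * `|det i j|.
  by move=> ij tE; rewrite /area detE (normD3_verts _ _ _ _ tE) // (inj_eq rI).
have det_neq0 i j : i != j -> det i j != 0.
  move=> ij; have rij : r i != r j by rewrite (inj_eq rI).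
  have [t tE] := triple_of (erN i) (erN j) rij.
  rewrite -normr_gt0; have := lt_le_trans D0 (minA t); rewrite (areaE t i j) //.
  by rewrite pmulr_rgt0 // invr_gt0.
have nbr i : exists j, M i j != 0.
  have [t [qt it]] := positive_component_covered compS (rS i) eS (re i).
  have [k ki tE] := rim_tri t i qt it; exists k; have ik : i != k by rewrite eq_sym.
  have : 0 < M i k * det i k.
    rewrite /M stress_entry mulr_suml (bigD1 t) //= ltr_pwDl //.
      by rewrite -mulrA Bt_spoke // mulr_gt0 // normr_gt0 det_neq0.
    by apply: sumr_ge0 => t' _; apply: term_ge0.
  by apply: contraTneq => ->; rewrite mul0r ltxx.
(* Zero row sums allow [u e] to be subtracted; then the column of [e] drops out, and columns outside
   the component vanish. *)
have rowE i (u : 'I_n -> R) : i \in S ->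
    \sum_j stress P q i j * u j = \sum_k stress P q i (r k) * (u (r k) - u e).
  move=> iS; transitivity (\sum_j stress P q i j * (u j - u e)).
    under [RHS]eq_bigr do rewrite mulrBr.
    by rewrite sumrB -mulr_suml stress_row_sum mul0r subr0.
  rewrite (bigID (mem (rim_labels hn))) /= [X in _ + X]big1 ?addr0.
    by rewrite big_imset //= => a b _ _; apply: rI.
  move=> j jr; have [->|je] := eqVneq j e; first by rewrite subrr mulr0.
  by rewrite (stress_outside P compS) ?mul0r // !inE negb_or je.
(* [rowE] is applied to the indicator of [e]. *)
have rowe j : stress P q e (r j) = \sum_k M j k.
  have := rowE (r j) (fun l => (l == e)%:R) (rS j).
  rewrite (bigD1 e) //= eqxx mulr1 big1 ?addr0 => [|l /negbTE->]; last by rewrite mulr0.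
  move=> h; rewrite stress_anti h -sumrN; apply: eq_bigr => k _.
  by rewrite (negbTE (re k)) sub0r mulrN1 opprK.
have [kerxi _] := kerB q qK.
have kerM i : \sum_j M i j * (xi (r j) 0 - xi e 0) = 0.
  by rewrite -(rowE (r i) (fun l => xi l 0)) //;
    move/matrixP/(_ (r i) 0): kerxi; rewrite !mxE.
have vE i c : v (r i) c = xi (r i) 0 * f1 0 c.
  by move/rowP/(_ c): (vrim i); rewrite !mxE.
have veE c : v e c = xi e 0 * f1 0 c by move/rowP/(_ c): ve; rewrite !mxE.
have f1_neq0 : (f1 0 0 != 0) || (f1 0 1 != 0).
  apply: contraT; rewrite negb_or !negbK => /andP[/eqP f0 /eqP f10].
  have /free_not0 := basis_free fbasis; move/(_ f1); rewrite inE eqxx => /(_ isT).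
  case/eqP; apply/rowP => c; rewrite mxE.
  by case: c => [[|[|c]]] // hc; [rewrite -[RHS]f0|rewrite -[RHS]f10];
    congr (f1 0 _); apply: val_inj.
(* The triangle [{e, r i, r j}] is tight, and the velocities relative to [e] are multiples of [f1],
   so its trace equation is this relation. *)
have coll i j : M i j != 0 ->
    (xi (r i) 0 - xi e 0) * (f1 0 0 * (y j - ye) - f1 0 1 * (x j - xe)) =
    (xi (r j) 0 - xi e 0) * (f1 0 0 * (y i - ye) - f1 0 1 * (x i - xe)).
  case/edge => ij [t [tt tE]].
  have Dt0 : Dt t P != 0.
    rewrite -normr_gt0; have := lt_le_trans D0 (minA t).
    by rewrite /area pmulr_rgt0 // invr_gt0.
  have rij : r i != r j by rewrite (inj_eq rI).
  have := D3_diff_verts (erN i) (erN j) rij tE (D3_diff_eq0 Dt0 (tightDA t tt)).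
  rewrite /D3_diff !vE !veE -/(x i) -/(x j) -/(y i) -/(y j) -/xe -/ye => h.
  by apply: subr0_eq; rewrite -[RHS]h; ring.
have [z [spokes leaves]] : exists z, (forall j, j != z -> M j z != 0) /\
    (forall j k, j != z -> k != z -> M j k = 0).
  apply: (@stress_star R M (fun i => x i - xe) (fun i => y i - ye)
    (fun i => xi (r i) 0 - xi e 0) (f1 0 0) (f1 0 1)) => // i.
  by apply/eqP => /addIr h; apply: (cycC i); rewrite h subrr.
(* Here [a] and [b] are the multipliers of the walls where the coordinate [c] is 0 and 1. *)
have force (c a b : R) : 0 <= a -> 0 <= b -> (c <> 1 -> b = 0) -> (c <> 0 -> a = 0) ->
    wall_force c (b - a).
  move=> a0 b0 c1 c0; split=> h; apply: contrapT => /[dup] hc.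
    by move/c1 => hb; move: h; rewrite hb; lra.
  by move/c0 => ha; move: h; rewrite ha; lra.
have forceX i : wall_force (P i xcoord) (q (Right i) - q (Left i)).
  by have [wl wr _ _] := wall i; apply: force.
have forceY i : wall_force (P i ycoord) (q (Up i) - q (Down i)).
  by have [_ _ wd wu] := wall i; apply: force.
have eqE i := equilibrium_entry i (equil q qK).
(* The parameter [d] is twice [mindelta P] because determinants are doubled areas. *)
apply: (@no_star_equilibrium R M x y
  (fun i => q (Right (r i)) - q (Left (r i))) (fun i => q (Up (r i)) - q (Down (r i)))
  xe ye (q (Right e) - q (Left e)) (q (Up e) - q (Down e)) (2 * mindelta P) z) => //.
- by rewrite mulr_gt0.
- move=> j jz; have [_ [t [tt tE]]] := edge _ _ (spokes j jz).
  rewrite -tt (areaE t j z) // mulrA divff ?pnatr_eq0 // mul1r -normrN.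
  by congr (`|_|); rewrite /det; ring.
- move=> i j k ij ik jk; have [|||t tE] := @triple_of _ (r i) (r j) (r k).
  1-3: by rewrite (inj_eq rI).
  have := strict_rim t i j k tE;
    rewrite /area (normD3_verts _ _ _ _ tE) ?(inj_eq rI) //.
  by rewrite D3E ltr_pdivlMl.
- by move=> i; rewrite -(eqE (r i)).1 (rowE _ (fun l => P l xcoord)).
- by move=> i; rewrite -(eqE (r i)).2 (rowE _ (fun l => P l ycoord)).
- rewrite -(eqE e).1 (rowE _ (fun l => P l xcoord)) //.
  by apply: eq_bigr => j _; rewrite rowe.
- rewrite -(eqE e).2 (rowE _ (fun l => P l ycoord)) //.
  by apply: eq_bigr => j _; rewrite rowe.
- by move=> i; exact: (forceX (r i)).
- by move=> i; exact: (forceY (r i)).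
- exact: forceX.
- exact: forceY.
- by move=> i; exact: (sqP (r i) xcoord).
- by move=> i; exact: (sqP (r i) ycoord).
Qed.
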